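(* Let $A \in \mathbb{R}^{m \times N}$, let $1 \le r \le \operatorname{rank} A$, and let $f > 1$. Apply the (transposed) algorithm pre-maxvol to $A$ to select $r$ starting columns, and then apply the algorithm Dominant-R with threshold parameter $f$, starting from these columns. Then after $O(r \log_f r)$ steps (column replacements; the implied constant is absolute) Dominant-R stops and outputs a submatrix $\hat A \in \mathbb{R}^{m \times r}$ (formed by $r$ columns of $A$) with $QR$ decomposition $\hat A = \tilde Q \tilde R$ such that $Q = \tilde Q$ and $R = \tilde Q^T A$ are, up to column permutation, a strong rank-revealing $QR$ decomposition of $A$ with factor $f$.
   Context: The volume of a matrix $B$ is the product of its singular values, $\mathcal{V}_2(B)=\prod_{i=1}^{\min(m,n)} \sigma_i(B)$ for $B$ of size $m \times n$ (singular values are in descending order). Transposed pre-maxvol: start with the empty set $\mathcal{J}$ of column indices; repeat $r$ times: among all columns of $A$, choose one whose orthogonal projection onto the orthogonal complement of the span of the columns already in $\mathcal{J}$ has the largest Euclidean norm, and add its index to $\mathcal{J}$. Dominant-R with threshold $f$: given a current set $\mathcal{J}$ of $r$ column indices, consider for every $j \in \mathcal{J}$ and $i \notin \mathcal{J}$ the factor $m_{ij}$ by which the squared volume of the $m \times r$ submatrix $A_{:,\mathcal{J}}$ changes when column $j$ is replaced by column $i$. While the maximum of $m_{ij}$ exceeds $f$, perform a replacement attaining this maximum (one step); otherwise stop and output $\hat A = A_{:,\mathcal{J}}$. $QR$ decomposition here is the full one, $\tilde Q \in \mathbb{R}^{m \times m}$ orthogonal and $\tilde R \in \mathbb{R}^{m\times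 r}$ upper triangular. Strong rank-revealing $QR$ with factor $f$ (in the sense of Gu and Eisenstat): a decomposition $A\Pi = Q \begin{bmatrix} A_r & B_r \\ 0 & C_r \end{bmatrix}$, with $\Pi$ a permutation matrix, $Q \in \mathbb{R}^{m\times m}$ orthogonal, $A_r \in \mathbb{R}^{r \times r}$ upper triangular and nonsingular, such that for all admissible indices $i, j$ $$\sigma_i(A_r) \ge \frac{\sigma_i(A)}{\sqrt{1+f^2 r(N-r)}}, \qquad \sigma_j(C_r) \le \sigma_{r+j}(A)\sqrt{1+f^2 r(N-r)}, \qquad \left|(A_r^{-1}B_r)_{ij}\right| \le f .$$ ''Up to column permutation'' means that $\Pi$ moves the selected columns to the first $r$ positions, so that $Q = \tilde Q$ and $R\,\Pi = \tilde Q^T A \Pi$ is the block matrix above. *)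

(* Defs.v *)
From HB Require Import structures.
From mathcomp Require Import all_boot all_order all_fingroup all_algebra.
From mathcomp Require Import polyrcf reals exp.

Set Implicit Arguments.
Unset Strict Implicit.
Unset Printing Implicit Defensive.

Import Order.TTheory GRing.Theory Num.Theory.
Local Open Scope ring_scope.

Definition logb (R : realType) (b x : R) : R := ln x / ln b.

(* Real eigenvalues in increasing order, repeated according to their algebraic
   multiplicity; for a symmetric matrix this is the whole spectrum. *)
Definition eigenvalues (R : realType) (n : nat) (M : 'M[R]_n) : seq R :=
  let p := char_poly M in flatten [seq nseq (mup x p) x | x <- rootsR p].

(* The i-th largest singular value of B, counting from i = 0, where the
   singular values are the square roots of the eigenvalues of B^T B. The value
   is 0 beyond the last one. *)
Definition sigma (R : realType) (m n : nat) (B : 'M[R]_(m, n)) (i : nat) : R :=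
  Num.sqrt (rev (eigenvalues (B^T *m B)))`_i.

Definition volume (R : realType) (m n : nat) (B : 'M[R]_(m, n)) : R :=
  \prod_(i < minn m n) sigma B i.

(* `|v| on 'rV[R]_n is the sup norm, hence this definition. *)
Definition norm2 (R : realType) (n : nat) (v : 'rV[R]_n) : R :=
  Num.sqrt (\sum_k v 0 k ^+ 2).

(* Row k of a matrix spans, so columns of A are transposed: the row space of
   col_span A J is the span of the columns of A with index in J. *)
Definition col_span (R : realType) (m N : nat) (A : 'M[R]_(m, N))
    (J : {set 'I_N}) : 'M[R]_m :=
  (\sum_(j in J) <<(col j A)^T>>)%MS.

Definition ortho_compl (R : realType) (m : nat) (W : 'M[R]_m) : 'M[R]_m :=
  kermx W^T.

(* Projecting onto the orthogonal complement parallel to the span itself is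
   the orthogonal projection. *)
Definition residual (R : realType) (m N : nat) (A : 'M[R]_(m, N))
    (J : {set 'I_N}) (i : 'I_N) : 'rV[R]_m :=
  (col i A)^T *m proj_mx (ortho_compl (col_span A J)) (col_span A J).

(* premaxvol A k J: J is a possible state after k greedy selections, ties
   being broken arbitrarily. *)
Inductive premaxvol (R : realType) (m N : nat) (A : 'M[R]_(m, N)) :
    nat -> {set 'I_N} -> Prop :=
| premaxvol0 : premaxvol A 0 set0
| premaxvolS (k : nat) (J : {set 'I_N}) (i : 'I_N) :
    premaxvol A k J ->
    (forall l : 'I_N, norm2 (residual A J l) <= norm2 (residual A J i)) ->
    premaxvol A k.+1 (i |: J).

(* Columns of A with index in J, in increasing order of the index. *)
Definition colset (R : realType) (m N : nat) (A : 'M[R]_(m, N))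
    (J : {set 'I_N}) : 'M[R]_(m, #|J|) :=
  colsub (fun k : 'I_(#|J|) => enum_val k) A.

Definition replace (N : nat) (J : {set 'I_N}) (i j : 'I_N) : {set 'I_N} :=
  i |: (J :\ j).

Definition factor (R : realType) (m N : nat) (A : 'M[R]_(m, N))
    (J : {set 'I_N}) (i j : 'I_N) : R :=
  volume (colset A (replace J i j)) ^+ 2 / volume (colset A J) ^+ 2.

Definition dominantR_stop (R : realType) (m N : nat) (A : 'M[R]_(m, N)) (f : R)
    (J : {set 'I_N}) : Prop :=
  forall i j : 'I_N, i \notin J -> j \in J -> factor A J i j <= f.

Definition dominantR_step (R : realType) (m N : nat) (A : 'M[R]_(m, N)) (f : R)
    (J J' : {set 'I_N}) : Prop :=
  exists i j : 'I_N,
    [/\ i \notin J /\ j \in J,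
        f < factor A J i j,
        (forall i' j' : 'I_N, i' \notin J -> j' \in J ->
           factor A J i' j' <= factor A J i j)
      & J' = replace J i j].

Inductive dominantR_run (R : realType) (m N : nat) (A : 'M[R]_(m, N)) (f : R) :
    nat -> {set 'I_N} -> {set 'I_N} -> Prop :=
| dominantR_run0 (J : {set 'I_N}) : dominantR_run A f 0 J J
| dominantR_runS (k : nat) (J J' J'' : {set 'I_N}) :
    dominantR_run A f k J J' -> dominantR_step A f J' J'' ->
    dominantR_run A f k.+1 J J''.

Definition orthogonal_mx (R : realType) (n : nat) (Q : 'M[R]_n) : Prop :=
  Q^T *m Q = 1%:M.

Definition upper_triangular (R : realType) (m n : nat) (T : 'M[R]_(m, n)) :
    Prop :=
  forall (i : 'I_m) (j : 'I_n), (j < i)%N -> T i j = 0.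

Definition full_qr (R : realType) (m n : nat) (B : 'M[R]_(m, n))
    (Q : 'M[R]_m) (T : 'M[R]_(m, n)) : Prop :=
  [/\ orthogonal_mx Q, upper_triangular T & B = Q *m T].

(* A *m P = Q *m T with T = [Ar Br; 0 Cr]; the equalities em and eN only
   identify the block dimensions with m and N. *)
Definition strong_rrqr (R : realType) (m N r : nat) (f : R) (A : 'M[R]_(m, N))
    (P : 'M[R]_N) (Q : 'M[R]_m) (T : 'M[R]_(m, N)) : Prop :=
  [/\ is_perm_mx P, orthogonal_mx Q, A *m P = Q *m T &
  exists (em : (r + (m - r))%N = m) (eN : (r + (N - r))%N = N)
         (Ar : 'M[R]_r) (Br : 'M[R]_(r, N - r)) (Cr : 'M[R]_(m - r, N - r)),
    let rho := Num.sqrt (1 + f ^+ 2 * r%:R * (N - r)%:R) in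
    [/\ T = castmx (em, eN) (block_mx Ar Br 0 Cr),
        upper_triangular Ar /\ Ar \in unitmx,
        (forall i : nat, (i < r)%N -> sigma Ar i >= sigma A i / rho),
        (forall j : nat, (j < minn (m - r) (N - r))%N ->
           sigma Cr j <= sigma A (r + j) * rho)
      & forall (i : 'I_r) (j : 'I_(N - r)),
          `|(invmx Ar *m Br) i j| <= f]].

(* Main.v *)
(* Step count: writing rho_1, ..., rho_r for the norms of the greedily chosen
   residuals, the squared volume of the starting columns is the product of the
   rho_k^2, and any r columns S of A have sigma_k(S)^2 <= r rho_k^2, since on a
   subspace of codimension < k every x satisfies |S x| = |P S x| with P the
   projection orthogonal to the first k-1 greedy columns. So no squared volume
   exceeds r^r times the starting one, and each step multiplies it by more
   than f; this gives at most r log_f r steps.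

   Quality of the output: with X = Ar^-1 Br, the factor of the exchange of
   columns k and j equals X_kj^2 + |row k of Ar^-1|^2 |column j of Cr|^2.
   Summing "all factors <= f" bounds |X|^2 + |Ar^-1|^2 |Cr|^2 in Frobenius norm
   by f r (N - r) <= f^2 r (N - r), and the two singular value inequalities
   follow from the Courant-Fischer principle in the coordinates
   (x + X y, y). *)

Require Import Defs.
From HB Require Import structures.
From mathcomp Require Import all_boot all_order all_fingroup all_algebra.
From mathcomp Require Import polyrcf reals exp complex ring zify.

Set Implicit Arguments.
Unset Strict Implicit.
Unset Printing Implicit Defensive.

Import Order.TTheory GRing.Theory Num.Theory.
Local Open Scope ring_scope.

(** * Frobenius norm *)

Definition sqn (R : pzRingType) (m n : nat) (M : 'M[R]_(m, n)) : R :=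
  \sum_i \sum_j M i j ^+ 2.

Lemma sqn_tr (R : pzRingType) (m n : nat) (M : 'M[R]_(m, n)) : sqn M^T = sqn M.
Proof.
rewrite /sqn exchange_big; apply: eq_bigr => i _; apply: eq_bigr => j _.
by rewrite mxE.
Qed.

Lemma sqn_trace (R : pzRingType) (m n : nat) (M : 'M[R]_(m, n)) :
  sqn M = \tr (M *m M^T).
Proof.
apply: eq_bigr => i _; rewrite mxE; apply: eq_bigr => j _.
by rewrite mxE expr2.
Qed.

Lemma sqn_mulmx_orth (R : comPzRingType) (m n p : nat) (M : 'M[R]_(m, n))
    (Q : 'M_(n, p)) :
  Q *m Q^T = 1%:M -> sqn (M *m Q) = sqn M.
Proof.
by move=> QQ; rewrite !sqn_trace trmx_mul mulmxA -(mulmxA M) QQ mulmx1.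
Qed.

Lemma sqn_ge0 (R : realDomainType) (m n : nat) (M : 'M[R]_(m, n)) : 0 <= sqn M.
Proof. by apply: sumr_ge0 => i _; apply: sumr_ge0 => j _; rewrite sqr_ge0. Qed.

Lemma sqn_eq0 (R : realDomainType) (m n : nat) (M : 'M[R]_(m, n)) :
  (sqn M == 0) = (M == 0).
Proof.
apply/eqP/eqP => [|->]; last first.
  by rewrite /sqn big1 // => i _; rewrite big1 // => j _; rewrite mxE expr0n.
have ge0 i : 0 <= \sum_j M i j ^+ 2 by apply: sumr_ge0 => j _; rewrite sqr_ge0.
move=> /psumr_eq0P M0; apply/matrixP => i j; rewrite mxE.
have /psumr_eq0P/(_ j isT) := M0 (fun i _ => ge0 i) i isT.
by move=> H; apply/eqP; rewrite -sqrf_eq0 H // => k _; rewrite sqr_ge0.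
Qed.

Lemma sqn_gt0 (R : realDomainType) (m n : nat) (M : 'M[R]_(m, n)) :
  (0 < sqn M) = (M != 0).
Proof. by rewrite lt_def sqn_ge0 andbT sqn_eq0. Qed.

Lemma sqn_row_mx (R : pzRingType) (m n p : nat) (A : 'M[R]_(m, n))
    (B : 'M_(m, p)) :
  sqn (row_mx A B) = sqn A + sqn B.
Proof.
rewrite /sqn -big_split; apply: eq_bigr => i _ /=; rewrite big_split_ord /=.
by congr (_ + _); apply: eq_bigr => j _; rewrite ?row_mxEl ?row_mxEr.
Qed.

Lemma sqn_row_sum (R : pzRingType) (m n : nat) (A : 'M[R]_(m, n)) :
  sqn A = \sum_i sqn (row i A).
Proof.
apply: eq_bigr => i _; rewrite /sqn big_ord1; apply: eq_bigr => j _.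
by rewrite mxE.
Qed.

Lemma sqn_col_sum (R : pzRingType) (m n : nat) (A : 'M[R]_(m, n)) :
  sqn A = \sum_j sqn (col j A).
Proof.
by rewrite -sqn_tr sqn_row_sum; apply: eq_bigr => j _; rewrite -tr_col sqn_tr.
Qed.

Lemma sqn_scale (R : comPzRingType) (m n : nat) (a : R) (A : 'M[R]_(m, n)) :
  sqn (a *: A) = a ^+ 2 * sqn A.
Proof.
rewrite /sqn mulr_sumr; apply: eq_bigr => i _; rewrite mulr_sumr.
by apply: eq_bigr => j _; rewrite mxE exprMn.
Qed.

Lemma sqn_opp (R : comPzRingType) (m n : nat) (A : 'M[R]_(m, n)) :
  sqn (- A) = sqn A.
Proof. by rewrite -scaleN1r sqn_scale sqrrN expr1n mul1r. Qed.

(** Lagrange's identity: twice the gap between the two sides is the sum of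
    [(a i * b j - a j * b i) ^+ 2] over all pairs. *)
Lemma cauchy_schwarz (R : realDomainType) (I : finType) (a b : I -> R) :
  (\sum_i a i * b i) ^+ 2 <= (\sum_i a i ^+ 2) * (\sum_i b i ^+ 2).
Proof.
have H : 0 <= \sum_i \sum_j (a i * b j - a j * b i) ^+ 2.
  by apply: sumr_ge0 => i _; apply: sumr_ge0 => j _; rewrite sqr_ge0.
rewrite -subr_ge0 -(pmulr_lge0 _ (ltr0n R 2 : 0 < 2%:R)).
apply: le_trans H _; rewrite le_eqVlt; apply/orP; left; apply/eqP.
pose G i j := a i ^+ 2 * b j ^+ 2 - a i * b i * (a j * b j).
rewrite (_ : \sum_i _ = \sum_i \sum_j (G i j + G j i)); last first.
  by apply: eq_bigr => i _; apply: eq_bigr => j _; rewrite /G; ring.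
under eq_bigr do rewrite big_split.
rewrite big_split /= [X in _ + X]exchange_big /= -mulr2n mulr_natr;
  congr (_ *+ 2).
rewrite expr2 !big_distrlr /= -sumrB; apply: eq_bigr => i _.
by rewrite -sumrB.
Qed.

(** Cauchy-Schwarz in each entry of the product. For a row [A] it bounds the operator norm by the
    Frobenius norm. *)
Lemma sqn_mulmx_le (R : realDomainType) (m n p : nat) (A : 'M[R]_(m, n))
    (B : 'M[R]_(n, p)) :
  sqn (A *m B) <= sqn A * sqn B.
Proof.
rewrite -(sqn_tr B) /sqn mulr_suml; apply: ler_sum => i _.
rewrite mulr_sumr; apply: ler_sum => j _.
rewrite mxE; apply: le_trans (cauchy_schwarz _ _) _.
by rewrite le_eqVlt; apply/orP; left; apply/eqP; congr (_ * _);
  apply: eq_bigr => k _; rewrite ?mxE.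
Qed.

(** * Spectral theorem for real symmetric matrices *)

Lemma orth_mxC (R : comUnitRingType) (n : nat) (Q : 'M[R]_n) :
  Q^T *m Q = 1%:M -> Q *m Q^T = 1%:M.
Proof. exact: mulmx1C. Qed.

(** Over the complex numbers [M] is Hermitian, hence unitarily diagonalizable with real spectrum; a
    real root of the complexified characteristic polynomial is a root of the original one. *)
Lemma symmetric_eigenvalue (R : rcfType) (n : nat) (M : 'M[R]_n.+1) :
  M^T = M -> exists a, eigenvalue M a.
Proof.
move=> Msym; pose Mc := map_mx (real_complex R) M.
have Mherm : Mc \is hermsymmx.
  apply: realsym_hermsym.
    by apply/is_hermitianmxP; rewrite expr0 scale1r map_mx_id // map_trmx Msym.
  by apply/mxOverP => i j; rewrite mxE; apply/complex_realP; exists (M i j).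
have /hermitian_normalmx/orthomx_spectralP := Mherm.
set P := spectralmx _; set d := spectral_diag _ => McE.
have Pu : P \in unitmx by apply: spectral_unit.
have /mxOverP/(_ 0 0)/complex_realP[a da] := hermitian_spectral_diag_real Mherm.
exists a; rewrite eigenvalue_root_char.
rewrite -(fmorph_root (real_complex R)) map_char_poly -/Mc (_ : _ a = d 0 0) //.
rewrite -eigenvalue_root_char; apply/eigenvalueP; exists (row 0 P).
  rewrite -row_mul McE !mulmxA mulmxV // mul1mx row_mul.
  by rewrite row_diag_mx -scalemxAl -rowE.
apply: contraTneq Pu => P0; rewrite -row_free_unit -kermx_eq0.
apply/eqP => K; have : delta_mx 0 0 *m P = 0 :> 'rV_n.+1 by rewrite -rowE.
move/sub_kermxP; rewrite K submx0 => /eqP/matrixP/(_ 0 0).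
by rewrite !mxE eqxx => /eqP; rewrite oner_eq0.
Qed.

(** [H] is the reflection across the hyperplane orthogonal to [w = v - c *: e], with [c] the
    Euclidean norm of [v]; for [w = 0] the identity serves. *)
Lemma householder (R : rcfType) (n : nat) (v : 'rV[R]_n.+1) :
  exists H : 'M[R]_n.+1, H^T *m H = 1%:M /\ exists c, v *m H = c *: delta_mx 0
    0.
Proof.
pose e : 'rV[R]_n.+1 := delta_mx 0 0; pose c := Num.sqrt (sqn v).
pose w := v - c *: e.
have [w0|w0] := eqVneq w 0.
  exists 1%:M; split; first by rewrite trmx1 mulmx1.
  exists c.
  by rewrite mulmx1; exact/subr0_eq/w0.
have sw : sqn w != 0 by rewrite sqn_eq0.
have wwT : w *m w^T = (sqn w)%:M by rewrite [LHS]mx11_scalar sqn_trace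
  trace_mx11.
have eeT : e *m e^T = 1%:M.
  by rewrite trmx_delta mul_delta_mx; apply/matrixP => i j; rewrite !ord1 !mxE.
have vvT : v *m v^T = (c ^+ 2)%:M.
  by rewrite [LHS]mx11_scalar -trace_mx11 -sqn_trace sqr_sqrtr ?sqn_ge0.
have veT : v *m e^T = (v 0 0)%:M.
  by rewrite [LHS]mx11_scalar trmx_delta -colE mxE.
have evT : e *m v^T = (v 0 0)%:M.
  by rewrite -[LHS]trmxK trmx_mul trmxK veT tr_scalar_mx.
pose H := 1%:M - (2 / sqn w) *: (w^T *m w).
have HT : H^T = H by rewrite /H raddfB /= linearZ /= trmx_mul trmxK trmx1.
exists H; split.
  rewrite HT /H; set X := (2 / sqn w) *: _.
  have XX : X *m X = X + X.
    rewrite /X -scalemxAl -scalemxAr -mulmxA (mulmxA w) wwT mul_scalar_mx.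
    by rewrite -scalemxAr !scalerA -scalerDl; congr (_ *: _); field.
  by rewrite mulmxBl mul1mx mulmxBr XX mulmx1 opprB addrK subrK.
(* As [v] and [c *: e] have equal norms, [v *m w^T] is half of [sqn w], so the reflection maps [v]
   to [v - w]. *)
exists c; have vwT : v *m w^T = (sqn w / 2)%:M.
  have -> : v *m w^T = (c ^+ 2 - c * v 0 0)%:M.
    rewrite /w raddfB /= mulmxBr linearZ /= -scalemxAr vvT veT.
    by rewrite scale_scalar_mx -raddfB.
  congr (_%:M); have : (sqn w)%:M = (2 * (c ^+ 2 - c * v 0 0))%:M :> 'M_1.
    rewrite -wwT /w raddfB /= mulmxBl !mulmxBr linearZ /= -!scalemxAr
      -!scalemxAl.
    rewrite vvT veT evT eeT !scale_scalar_mx -!raddfB /=; congr (_%:M); ring.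
  by move=> /matrixP/(_ 0 0); rewrite !mxE eqxx !mulr1n => ->; field.
rewrite /H mulmxBr mulmx1 -scalemxAr mulmxA vwT mul_scalar_mx scalerA.
have -> : 2 / sqn w * (sqn w / 2) = 1 by field.
by rewrite scale1r /w opprB addrC subrK.
Qed.

Lemma orthogonal_block (R : pzRingType) (n p : nat) (Q : 'M[R]_p) :
  Q^T *m Q = 1%:M ->
  (block_mx (1%:M : 'M_n) 0 0 Q)^T *m block_mx (1%:M : 'M_n) 0 0 Q = 1%:M.
Proof.
move=> QQ; rewrite tr_block_mx mulmx_block !trmx0 !mulmx0 !mul0mx trmx1 mulmx1
  QQ.
by rewrite !addr0 add0r -scalar_mx_block.
Qed.

Lemma orthogonal_mulmx (R : comPzRingType) (n : nat) (P Q : 'M[R]_n) :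
  P^T *m P = 1%:M -> Q^T *m Q = 1%:M -> (P *m Q)^T *m (P *m Q) = 1%:M.
Proof. by move=> PP QQ; rewrite trmx_mul mulmxA -(mulmxA Q^T) PP mulmx1. Qed.

(** Deflation: a reflection carries an eigenvector to a multiple of the first basis vector, and by
    symmetry the first row and column of the conjugate then vanish off the diagonal. *)
Lemma spectral_theorem (R : rcfType) (n : nat) (M : 'M[R]_n) :
  M^T = M ->
  exists (Q : 'M_n) (d : 'rV_n), Q^T *m Q = 1%:M /\ M = Q *m diag_mx d *m Q^T.
Proof.
elim: n M => [|n IHn] M Msym.
  by exists 1%:M, 0; split; apply/matrixP => - [].
have [a /eigenvalueP[v vM v0]] := symmetric_eigenvalue Msym.
have [H [HH [c vH]]] := householder v.
have HH' := orth_mxC HH.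
have c0 : c != 0.
  apply: contraNneq v0 => c0; rewrite -(mulmx1 v) -HH' mulmxA vH c0.
  by rewrite scale0r mul0mx.
pose M' : 'M_(1 + n) := H^T *m M *m H.
have M'sym : M'^T = M' by rewrite /M' !trmx_mul trmxK Msym mulmxA.
have row0 : row 0 M' = a *: delta_mx 0 0.
  apply: (scalerI c0); rewrite rowE scalemxAl -vH /M' !mulmxA.
  by rewrite -(mulmxA v) HH' mulmx1 vM -scalemxAl vH !scalerA mulrC.
have MM' : M = H *m M' *m H^T.
  by rewrite /M' !mulmxA HH' mul1mx -mulmxA HH' mulmx1.
clearbody M'.
have M'E : M' = block_mx a%:M 0 0 (drsubmx M').
  rewrite -[LHS]submxK; congr block_mx.
  - apply/matrixP => i j; rewrite !ord1.
    have /matrixP/(_ 0 0) := row0; rewrite !mxE !eqxx mulr1 mulr1n => <-.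
    by congr (M' _ _); apply: val_inj.
  - apply/matrixP => i j; rewrite !ord1.
    have /matrixP/(_ 0 (rshift 1 j)) := row0; rewrite !mxE /= mulr0 => <-.
    by congr (M' _ _); apply: val_inj.
  - apply/matrixP => i j; rewrite !ord1 -M'sym.
    have /matrixP/(_ 0 (rshift 1 i)) := row0; rewrite !mxE /= mulr0 => <-.
    by congr (M' _ _); apply: val_inj.
have [|Q [d [QQ M''E]]] := IHn (drsubmx M').
  by rewrite -[in RHS]M'sym; apply/matrixP => i j; rewrite !mxE.
pose B : 'M_(1 + n) := block_mx 1%:M 0 0 Q.
pose D : 'rV_(1 + n) := row_mx a%:M d.
have core : M' = B *m diag_mx D *m B^T.
  rewrite M'E diag_mx_row /B tr_block_mx !mulmx_block !trmx0 trmx1.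
  rewrite !(mulmx0, mul0mx, mul1mx, mulmx1, addr0, add0r) -M''E.
  by congr block_mx; apply/matrixP => i j; rewrite !ord1 !mxE eqxx !mulr1n.
exists (H *m B), D; split.
  by apply: orthogonal_mulmx => //; exact: (@orthogonal_block _ 1 n Q QQ).
by rewrite MM' core trmx_mul !mulmxA.
Qed.

(** * Eigenvalue lists from the characteristic polynomial *)

Lemma char_poly_conj (R : comNzRingType) (n : nat) (P M Q : 'M[R]_n) :
  P *m Q = 1%:M -> char_poly (P *m M *m Q) = char_poly M.
Proof.
move=> PQ; rewrite /char_poly.
have PQ' : map_mx polyC P *m map_mx polyC Q = 1%:M.
  by rewrite -map_mxM PQ map_mx1.
suff -> : char_poly_mx (P *m M *m Q) =
    map_mx polyC P *m char_poly_mx M *m map_mx polyC Q.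
  rewrite !det_mulmx mulrAC -det_mulmx PQ' det1 mul1r //.
rewrite /char_poly_mx mulmxBr mulmxBl -!map_mxM -scalemx1 -scalemxAr mulmx1.
by rewrite -scalemxAl PQ'.
Qed.

(** The characteristic polynomial is the product of the ['X - (d 0 i)%:P], so the multiplicity of
    [x] as a root is its number of occurrences in [d]. *)
Lemma perm_eigenvalues (R : realType) (n : nat) (Q M : 'M[R]_n) (d : 'rV_n) :
  Q^T *m Q = 1%:M -> M = Q *m diag_mx d *m Q^T ->
  perm_eq (eigenvalues M) [seq d 0 i | i : 'I_n].
Proof.
move=> QQ ME; set s := [seq _ | _ : _].
have pE : char_poly M = \prod_(x <- s) ('X - x%:P).
  rewrite ME char_poly_conj; last exact: orth_mxC.
  rewrite char_poly_trig ?diag_mx_is_trig // big_image /=.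
  by apply: eq_bigr => i _; rewrite mxE eqxx mulr1n.
have p0 : char_poly M != 0 by rewrite monic_neq0 ?char_poly_monic.
apply/allP => x _ /=; apply/eqP.
rewrite -(mu_prod_XsubC x s) -pE /eigenvalues count_flatten -map_comp.
have -> : [seq (count_mem x \o (fun y => nseq (mup y (char_poly M)) y)) i
    | i <- rootsR (char_poly M)] =
   [seq (if y == x then mup x (char_poly M) else 0)%N | y <- rootsR (char_poly
     M)].
  apply: eq_map => y /=; rewrite count_nseq /=; case: eqP => [->|_];
    first by rewrite mul1n.
  by rewrite mul0n.
rewrite sumnE big_map -big_mkcond /= big_const_seq iter_addn addn0.
(* [rootsR] has no repetitions, so a root counts once; a non-root counts zero times and has
   multiplicity zero. *)
have -> : count (eq_op^~ x) (rootsR (char_poly M)) = root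
  (char_poly M) x :> nat.
  rewrite -(@eq_count _ (pred1 x)) // count_uniq_mem ?uniq_roots //.
  by have /(_ x) := roots_on_rootsR p0; rewrite in_itv /= => ->.
by case: (boolP (root _ _)) => [|/mupNroot->]; rewrite ?muln1.
Qed.

Lemma sorted_eigenvalues (R : realType) (n : nat) (M : 'M[R]_n) :
  sorted <=%R (eigenvalues M).
Proof.
rewrite /eigenvalues; set p := char_poly M.
have : sorted <%R (rootsR p) by apply: sorted_roots.
rewrite (sorted_pairwise lt_trans) (sorted_pairwise le_trans).
elim: (rootsR p) => //= x s IHs /andP[xs /IHs IH].
rewrite pairwise_cat IH andbT; apply/andP; split; last first.
  by elim: (mup x p) => //= k ->; rewrite andbT all_nseq lexx orbT.
apply/allrelP => y z /nseqP[-> _] /flattenP[_ /mapP[w ws ->] /nseqP[-> _]].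
by apply/ltW; exact: (allP xs).
Qed.

(** * Singular values and the Courant-Fischer principle *)

(** The spectral theorem leaves the order of the diagonal open; permuting the columns of [Q] matches
    it with the decreasing order of [sigma]. *)
Lemma sigma_diag (R : realType) (m n : nat) (B : 'M[R]_(m, n)) :
  exists Q : 'M[R]_n, Q^T *m Q = 1%:M /\
    B^T *m B = Q *m diag_mx (\row_i sigma B i ^+ 2) *m Q^T.
Proof.
have [|Q [d [QQ ME]]] := @spectral_theorem R n (B^T *m B).
  by rewrite trmx_mul trmxK.
have d_ge0 i : 0 <= d 0 i.
  have : diag_mx d = (Q^T *m B^T) *m (Q^T *m B^T)^T.
    rewrite trmx_mul !trmxK mulmxA -(mulmxA _ B^T) ME !mulmxA QQ mul1mx.
    by rewrite -mulmxA QQ mulmx1.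
  move=> /matrixP/(_ i i); rewrite !mxE eqxx mulr1n => ->.
  by apply: sumr_ge0 => k _; rewrite [X in _ * X]mxE -expr2 sqr_ge0.
have le_size : size (rev (eigenvalues (B^T *m B))) == n.
  by rewrite size_rev (perm_size (perm_eigenvalues QQ ME)) size_map -cardE
    card_ord.
have /tuple_permP[s sE] : perm_eq (Tuple le_size) [tuple d 0 i | i < n].
  by rewrite /= perm_rev (perm_eigenvalues QQ ME).
have sigE (i : 'I_n) : sigma B i ^+ 2 = d 0 (s i).
  rewrite /sigma [rev _]sE (nth_map i) ?size_enum_ord // nth_ord_enum.
  by rewrite tnth_map tnth_ord_tuple sqr_sqrtr.
exists (col_perm s Q); split.
  apply/matrixP => i j; rewrite !mxE.
  have /matrixP/(_ (s i) (s j)) := QQ; rewrite !mxE (inj_eq perm_inj) => <-.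
  by apply: eq_bigr => k _; rewrite !mxE.
rewrite ME; apply/matrixP => i j; rewrite !mul_mx_diag !mxE (reindex_perm s).
by apply: eq_bigr => k _; rewrite !mxE sigE.
Qed.

Lemma sigma_ge0 (R : realType) (m n : nat) (B : 'M[R]_(m, n)) (i : nat) :
  0 <= sigma B i.
Proof. exact: sqrtr_ge0. Qed.

Lemma size_eigenvalues_gram (R : realType) (m n : nat) (B : 'M[R]_(m, n)) :
  size (eigenvalues (B^T *m B)) = n.
Proof.
have [Q [QQ ME]] := sigma_diag B.
by rewrite (perm_size (perm_eigenvalues QQ ME)) size_map -cardE card_ord.
Qed.

Lemma sigma_oversize (R : realType) (m n : nat) (B : 'M[R]_(m, n)) (i : nat) :
  (n <= i)%N -> sigma B i = 0.
Proof.
by move=> ni; rewrite /sigma nth_default ?sqrtr0 // size_rev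
  size_eigenvalues_gram.
Qed.

Lemma sigma_nonincreasing (R : realType) (m n : nat) (B : 'M[R]_(m, n))
    (i j : nat) :
  (i <= j)%N -> sigma B j <= sigma B i.
Proof.
move=> ij; have [nj|jn] := leqP n j.
  by rewrite (sigma_oversize _ nj) sigma_ge0.
apply: ler_wsqrtr; set l := rev _.
have : sorted >=%R l by rewrite rev_sorted sorted_eigenvalues.
move=> /(sorted_leq_nth (rev_trans le_trans) lexx 0); apply => //.
all: by rewrite inE size_rev size_eigenvalues_gram // (leq_ltn_trans ij).
Qed.

(** Vectors are rows, so [x *m B^T] is the image of [x] under [B]; [x *m Q] gives the coordinates in
    right singular vectors. *)
Lemma sigma_form (R : realType) (m n : nat) (B : 'M[R]_(m, n)) :
  exists Q : 'M[R]_n, Q^T *m Q = 1%:M /\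
    forall x : 'rV_n,
      sqn (x *m B^T) = \sum_(i < n) sigma B i ^+ 2 * (x *m Q) 0 i ^+ 2.
Proof.
have [Q [QQ ME]] := sigma_diag B; exists Q; split=> // x.
rewrite sqn_trace trace_mx11 trmx_mul trmxK mulmxA -(mulmxA x) ME !mulmxA.
rewrite -(mulmxA _ Q^T) -trmx_mul mul_mx_diag !mxE; apply: eq_bigr => i _.
by rewrite !mxE mulrC mulrA -expr2 mulrC.
Qed.

Lemma det_gram (R : realType) (m n : nat) (B : 'M[R]_(m, n)) :
  \det (B^T *m B) = \prod_(i < n) sigma B i ^+ 2.
Proof.
have [Q [QQ ->]] := sigma_diag B.
rewrite !det_mulmx mulrAC -det_mulmx (orth_mxC QQ) det1 mul1r det_diag.
by apply: eq_bigr => i _; rewrite mxE.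
Qed.

Lemma sigma_orthogonal (R : realType) (m n : nat) (Q : 'M[R]_m) (B : 'M_(m, n))
    (P : 'M_n) (i : nat) :
  Q^T *m Q = 1%:M -> P *m P^T = 1%:M -> sigma (Q *m B *m P) i = sigma B i.
Proof.
move=> QQ PP; rewrite /sigma !trmx_mul !mulmxA -(mulmxA _ Q^T) QQ mulmx1.
by rewrite -(mulmxA P^T) /eigenvalues char_poly_conj // mulmx1C.
Qed.

Lemma volume_sqr (R : realType) (m n : nat) (B : 'M[R]_(m, n)) :
  (n <= m)%N -> volume B ^+ 2 = \det (B^T *m B).
Proof. by move=> /minn_idPr nm; rewrite /volume nm det_gram -prodrXl. Qed.

(** Courant-Fischer, upper bound: a space of codimension at most [i] meets the span of the first
    [i + 1] right singular vectors, where [B] stretches by at least [sigma B i]. For [i >= n] the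
    value of [sigma] is 0. *)
Lemma sigma_ler_sub (R : realType) (m n p : nat) (B : 'M[R]_(m, n))
    (U : 'M_(p, n)) (i : nat) (c : R) :
  0 <= c -> (n <= \rank U + i)%N ->
  (forall x : 'rV_n, (x <= U)%MS -> sqn (x *m B^T) <= c * sqn x) ->
  sigma B i ^+ 2 <= c.
Proof.
move=> c0 rU Uc; have [ni|lt_in] := leqP n i.
  by rewrite (sigma_oversize _ ni) expr0n.
have [Q [QQ BQ]] := sigma_form B.
have QQ' := orth_mxC QQ.
pose V := (pid_mx i.+1 : 'M[R]_n) *m Q^T.
have Vu : Q^T \in unitmx by case/mulmx1_unit: QQ.
have rV : \rank V = i.+1 by rewrite mxrankMfree ?row_free_unit // rank_pid_mx.
have cap0 : (U :&: V)%MS != 0.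
  rewrite -mxrank_eq0 -lt0n.
  have := mxrank_sum_cap U V; have := rank_leq_col (U + V)%MS; rewrite rV; lia.
have /rowV0Pn[x] := cap0; rewrite sub_capmx => /andP[xU /submxP[y yV]] x0.
have := Uc x xU; rewrite BQ => Hx.
have sx : sqn x = \sum_(k < n) (x *m Q) 0 k ^+ 2.
  by rewrite -(sqn_mulmx_orth x QQ') /sqn big_ord1.
have sxp : 0 < sqn x by rewrite sqn_gt0.
rewrite -(ler_pM2r sxp); apply: le_trans Hx; rewrite sx mulr_sumr.
apply: ler_sum => k _; have [ki|ik] := leqP k i.
  by rewrite ler_wpM2r ?sqr_ge0 // lerXn2r ?nnegrE ?sigma_ge0 //
    sigma_nonincreasing.
suff -> : (x *m Q) 0 k = 0 by rewrite expr0n !mulr0.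
rewrite yV -mulmxA /V -mulmxA QQ mulmx1 mxE big1 // => l _.
rewrite mxE; case: eqP => [->|_] /=; last by rewrite mulr0.
by rewrite ltnNge ik mulr0.
Qed.

(** Dually, a space of dimension above [i] meets the span of the right singular vectors from index
    [i] on, where [B] stretches by at most [sigma B i]. *)
Lemma sub_ler_sigma (R : realType) (m n p : nat) (B : 'M[R]_(m, n))
    (U : 'M_(p, n)) (i : nat) (c : R) :
  (i < \rank U)%N ->
  (forall x : 'rV_n, (x <= U)%MS -> c * sqn x <= sqn (x *m B^T)) ->
  c <= sigma B i ^+ 2.
Proof.
move=> rU Uc; have lt_in : (i < n)%N by apply: leq_trans rU (rank_leq_col _).
have [Q [QQ BQ]] := sigma_form B.
have QQ' := orth_mxC QQ.
pose V := (copid_mx i : 'M[R]_n) *m Q^T.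
have Vu : Q^T \in unitmx by case/mulmx1_unit: QQ.
have rV : \rank V = (n - i)%N.
  by rewrite mxrankMfree ?row_free_unit // rank_copid_mx // ltnW.
have cap0 : (U :&: V)%MS != 0.
  rewrite -mxrank_eq0 -lt0n.
  have := mxrank_sum_cap U V; have := rank_leq_col (U + V)%MS; rewrite rV; lia.
have /rowV0Pn[x] := cap0; rewrite sub_capmx => /andP[xU /submxP[y yV]] x0.
have := Uc x xU; rewrite BQ => Hx.
have sx : sqn x = \sum_(k < n) (x *m Q) 0 k ^+ 2.
  by rewrite -(sqn_mulmx_orth x QQ') /sqn big_ord1.
have sxp : 0 < sqn x by rewrite sqn_gt0.
rewrite -(ler_pM2r sxp); apply: le_trans Hx _; rewrite sx mulr_sumr.
apply: ler_sum => k _; have [ik|ki] := leqP i k.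
  by rewrite ler_wpM2r ?sqr_ge0 // lerXn2r ?nnegrE ?sigma_ge0 //
    sigma_nonincreasing.
suff -> : (x *m Q) 0 k = 0 by rewrite expr0n !mulr0.
rewrite yV -mulmxA /V -mulmxA QQ mulmx1 mxE big1 // => l _.
rewrite !mxE -val_eqE /=; case: eqP => [->|_]; last by rewrite subrr mulr0.
by rewrite ki subrr mulr0.
Qed.

(** The right singular vectors from index [i] on span such a space. *)
Lemma sigma_upper_space (R : realType) (m n : nat) (B : 'M[R]_(m, n))
    (i : nat) :
  (i <= n)%N -> exists2 U : 'M[R]_n, \rank U = (n - i)%N &
    forall x : 'rV_n, (x <= U)%MS -> sqn (x *m B^T) <= sigma B i ^+ 2 * sqn x.
Proof.
move=> le_in; have [Q [QQ BQ]] := sigma_form B.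
exists ((copid_mx i : 'M[R]_n) *m Q^T).
  rewrite mxrankMfree ?rank_copid_mx // row_free_unit.
  by case/mulmx1_unit: QQ.
move=> _ /submxP[y ->]; set x := y *m _; rewrite BQ.
have -> : sqn x = \sum_(k < n) (x *m Q) 0 k ^+ 2.
  by rewrite -(sqn_mulmx_orth x (orth_mxC QQ)) /sqn big_ord1.
rewrite mulr_sumr; apply: ler_sum => k _; have [ik|ki] := leqP i k.
  by rewrite ler_wpM2r ?sqr_ge0 // lerXn2r ?nnegrE ?sigma_ge0 //
    sigma_nonincreasing.
suff -> : (x *m Q) 0 k = 0 by rewrite expr0n !mulr0.
rewrite /x -!mulmxA QQ mulmx1 mxE big1 // => l _.
rewrite !mxE -val_eqE /=; case: eqP => [->|_]; last by rewrite subrr mulr0.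
by rewrite ki subrr mulr0.
Qed.

(** Here the first [i + 1] right singular vectors serve. *)
Lemma sigma_lower_space (R : realType) (m n : nat) (B : 'M[R]_(m, n))
    (i : nat) :
  (i < n)%N -> exists2 U : 'M[R]_n, \rank U = i.+1 &
    forall x : 'rV_n, (x <= U)%MS -> sigma B i ^+ 2 * sqn x <= sqn (x *m B^T).
Proof.
move=> lt_in; have [Q [QQ BQ]] := sigma_form B.
exists ((pid_mx i.+1 : 'M[R]_n) *m Q^T).
  rewrite mxrankMfree ?rank_pid_mx // row_free_unit.
  by case/mulmx1_unit: QQ.
move=> _ /submxP[y ->]; set x := y *m _; rewrite BQ.
have -> : sqn x = \sum_(k < n) (x *m Q) 0 k ^+ 2.
  by rewrite -(sqn_mulmx_orth x (orth_mxC QQ)) /sqn big_ord1.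
rewrite mulr_sumr; apply: ler_sum => k _; have [ki|ik] := leqP k i.
  by rewrite ler_wpM2r ?sqr_ge0 // lerXn2r ?nnegrE ?sigma_ge0 //
    sigma_nonincreasing.
suff -> : (x *m Q) 0 k = 0 by rewrite expr0n !mulr0.
rewrite /x -!mulmxA QQ mulmx1 mxE big1 // => l _.
rewrite mxE; case: eqP => [->|_] /=; last by rewrite mulr0.
by rewrite ltnNge ik mulr0.
Qed.

(** * QR decomposition and Gram determinants *)

(** Triangle inequality followed by Cauchy-Schwarz on the weights, without square roots: entrywise
    the gap is the square [(be * u - al * v) ^+ 2], up to division by [al * be]. *)
Lemma sqnD_le (R : realFieldType) (m n : nat) (U V : 'M[R]_(m, n))
    (al be a b : R) :
  0 <= al -> 0 <= be -> 0 <= a -> 0 <= b ->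
  sqn U <= al * a -> sqn V <= be * b -> sqn (U + V) <= (al + be) * (a + b).
Proof.
move=> al0 be0 a0 b0 Ua Vb.
have [al_eq0|alN0] := eqVneq al 0.
  have /eqP -> : U == 0 by rewrite -sqn_eq0 eq_le sqn_ge0 andbT -(mul0r a)
    -al_eq0.
  rewrite add0r al_eq0 add0r; apply: le_trans Vb _.
  by rewrite ler_wpM2l // lerDr.
have [be_eq0|beN0] := eqVneq be 0.
  have /eqP -> : V == 0 by rewrite -sqn_eq0 eq_le sqn_ge0 andbT -(mul0r b)
    -be_eq0.
  rewrite addr0 be_eq0 addr0; apply: le_trans Ua _.
  by rewrite ler_wpM2l // lerDl.
have ab0 : 0 < al * be by rewrite mulr_gt0 // lt_def ?alN0 ?beN0.
have H : al * be * sqn (U + V) <= (al + be) * (be * sqn U + al * sqn V).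
  rewrite /sqn !mulr_sumr -big_split mulr_sumr; apply: ler_sum => i _.
  rewrite !mulr_sumr -big_split mulr_sumr; apply: ler_sum => j _ /=.
  rewrite mxE -subr_ge0; set u := U i j; set v := V i j.
  by rewrite (_ : _ - _ = (be * u - al * v) ^+ 2) ?sqr_ge0 //; ring.
rewrite -(ler_pM2l ab0); apply: le_trans H _.
rewrite mulrCA ler_wpM2l ?addr_ge0 // mulrDr lerD //.
  by rewrite -mulrA mulrCA ler_wpM2l.
by rewrite -mulrA ler_wpM2l.
Qed.

(** A reflection clears the first column below its top entry; induction treats the lower right
    block. *)
Lemma qr_exists (R : realType) (m n : nat) (B : 'M[R]_(m, n)) :
  exists (Q : 'M[R]_m) (T : 'M[R]_(m, n)), full_qr B Q T.
Proof.
elim: n m B => [|n IHn] m B.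
  by exists 1%:M, B; split; rewrite /orthogonal_mx ?trmx1 ?mul1mx // => i [].
case: m B => [|m] B.
  by exists 1%:M, B; split; rewrite /orthogonal_mx ?trmx1 ?mul1mx // => - [].
have [H [HH [c vH]]] := householder (col 0 B)^T.
pose B' : 'M_(1 + m, 1 + n) := H^T *m B.
have BE : B = H *m B' by rewrite /B' mulmxA (orth_mxC HH) mul1mx.
have col0 : col 0 B' = c *: delta_mx 0 0.
  by rewrite colE /B' -mulmxA -colE -[LHS]trmxK trmx_mul trmxK vH linearZ /=
    trmx_delta.
clearbody B'.
have B'E : B' = block_mx c%:M (ursubmx B') 0 (drsubmx B').
  rewrite -[LHS]submxK; congr block_mx.
  - apply/matrixP => i j; rewrite !ord1.
    have /matrixP/(_ 0 0) := col0; rewrite !mxE !eqxx mulr1 mulr1n => <-.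
    by congr (B' _ _); apply: val_inj.
  - apply/matrixP => i j; rewrite !ord1.
    have /matrixP/(_ (rshift 1 i) 0) := col0; rewrite !mxE /= mulr0 => <-.
    by congr (B' _ _); apply: val_inj.
have [Q [T [QQ TU DE]]] := IHn m (drsubmx B').
pose QB : 'M_(1 + m) := block_mx 1%:M 0 0 Q.
pose TB : 'M_(1 + m, 1 + n) := block_mx c%:M (ursubmx B') 0 T.
have core : B' = QB *m TB.
  rewrite B'E /QB /TB mulmx_block.
  by rewrite !(mulmx0, mul0mx, mul1mx, addr0, add0r) -DE.
exists (H *m QB), TB; split; last by rewrite BE core mulmxA.
  by apply: orthogonal_mulmx => //; exact: (@orthogonal_block _ 1 m Q QQ).
move=> i j; case: (@split_ordP 1 m i) => i' ->; first by rewrite ord1.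
case: (@split_ordP 1 n j) => j' ->;
  first by rewrite /TB (@block_mxEdl _ 1 m 1 n) mxE.
by rewrite /TB (@block_mxEdr _ 1 m 1 n) => /TU.
Qed.

(** The squared volume when [n <= m], in a form where column operations become determinant
    identities. *)
Definition gram (R : pzRingType) (m n : nat) (B : 'M[R]_(m, n)) : R :=
  \det (B^T *m B).

Lemma gram_orth (R : comPzRingType) (m n p : nat) (Q : 'M[R]_(p, m))
    (B : 'M_(m, n)) :
  Q^T *m Q = 1%:M -> gram (Q *m B) = gram B.
Proof.
by move=> QQ; rewrite /gram trmx_mul mulmxA -(mulmxA _ Q^T) QQ mulmx1.
Qed.

Lemma gram_col_perm (R : comPzRingType) (m n : nat) (s : 'S_n)
    (B : 'M[R]_(m, n)) :
  gram (col_perm s B) = gram B.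
Proof.
rewrite /gram col_permE trmx_mul mulmxA -(mulmxA _ B^T) !det_mulmx det_tr.
by rewrite det_perm mulrAC -expr2 sqrr_sign mul1r.
Qed.

(** The orderings by [c] and by increasing index differ by a permutation, which a Gram determinant
    does not see. *)
Lemma gram_colset (R : realType) (m n N : nat) (A : 'M[R]_(m, N))
    (c : 'I_n -> 'I_N) (J : {set 'I_N}) :
  injective c -> [set c k | k : 'I_n] = J -> (n <= m)%N ->
  volume (colset A J) ^+ 2 = gram (colsub c A).
Proof.
move=> ci cJ; have cn : n = #|J| by rewrite -cJ card_imset // card_ord.
subst n => nm; rewrite volume_sqr // -/(gram _).
have ex (k : 'I_#|J|) : exists l : 'I_#|J|, c l == enum_val k.
  have kJ := enum_valP k.
  suff /imsetP[l _ ->] : enum_val k \in [set c l | l : 'I_#|J|] by exists l.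
  by rewrite cJ.
pose g k := xchoose (ex k).
have gE k : c (g k) = enum_val k by apply/eqP/(xchooseP (ex k)).
have gi : injective g by move=> k l gkl; apply: enum_val_inj; rewrite -!gE gkl.
rewrite -(gram_col_perm (perm gi) (colsub c A)); congr (gram _).
by apply/matrixP => i j; rewrite !mxE permE gE.
Qed.

(** Height times base: adding [S *m y] to [u] is a unimodular column operation, and orthogonality
    makes the Gram matrix of [row_mx u S] block diagonal. *)
Lemma gram_extend (R : comPzRingType) (m n : nat) (u : 'cV[R]_m)
    (S : 'M_(m, n)) (y : 'cV_n) :
  S^T *m u = 0 ->
  gram (row_mx (u + S *m y) S : 'M_(m, 1 + n)) = sqn u * gram S.
Proof.
move=> Su; have uS : u^T *m S = 0 by rewrite -[LHS]trmxK trmx_mul trmxK Su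
  trmx0.
have -> : row_mx (u + S *m y) S = row_mx u S *m block_mx 1%:M 0 y 1%:M.
  by rewrite mul_row_block !mulmx1 mulmx0 add0r.
rewrite /gram trmx_mul mulmxA -(mulmxA _ (row_mx u S)^T) !det_mulmx.
rewrite det_tr det_lblock !det1 !mul1r !mulr1 tr_row_mx mul_col_row Su uS.
by rewrite det_ublock -sqn_tr sqn_trace trmxK trace_mx11 det_mx11.
Qed.

Lemma cofactor_eq_col (R : pzRingType) (n : nat) (A B : 'M[R]_n) (i j : 'I_n) :
  (forall k l, k != i -> l != j -> A k l = B k l) -> cofactor A i j = cofactor
    B i j.
Proof.
move=> AB; rewrite /cofactor; congr (_ * \det _); apply/matrixP => k l.
by rewrite !mxE AB // eq_sym neq_lift.
Qed.

Lemma cofactor_unit (R : comUnitRingType) (n : nat) (A : 'M[R]_n) (i j : 'I_n) :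
  A \in unitmx -> cofactor A i j = \det A * invmx A j i.
Proof.
move=> Au; have -> : cofactor A i j = (\adj A) j i by rewrite mxE.
by rewrite /invmx Au [in RHS]mxE mulrA mulrV ?mul1r.
Qed.

Definition set_col (R : Type) (m n : nat) (A : 'M[R]_(m, n)) (k : 'I_n)
  (b : 'cV[R]_m) :
    'M_(m, n) :=
  \matrix_(i, j) if j == k then b i 0 else A i j.

(** Cramer's rule, by expansion along column [k], whose cofactors are those of [A]. *)
Lemma det_set_col (R : comUnitRingType) (n : nat) (A : 'M[R]_n) (k : 'I_n)
    (b : 'cV[R]_n) :
  A \in unitmx -> \det (set_col A k b) = \det A * (invmx A *m b) k 0.
Proof.
move=> Au; rewrite (expand_det_col _ k) mxE mulr_sumr; apply: eq_bigr => i _.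
rewrite mxE eqxx (@cofactor_eq_col _ _ _ A); first by rewrite cofactor_unit //;
  ring.
by move=> h l _ /negPf lk; rewrite mxE lk.
Qed.

(* det (M + g E_kk) = det M + g (cofactor of M at (k,k)), applied to the Gram
   matrix of the upper block. *)
Lemma gram_set_col (R : comUnitRingType) (r p : nat) (A : 'M[R]_r) (k : 'I_r)
    (b : 'cV[R]_r) (g : 'cV[R]_p) :
  A \in unitmx ->
  gram (col_mx (set_col A k b) (set_col 0 k g)) =
  gram A * ((invmx A *m b) k 0 ^+ 2 + sqn (row k (invmx A)) * sqn g).
Proof.
move=> Au; rewrite {1}/gram tr_col_mx mul_row_col.
set A' := set_col A k b; set G := _ + _.
have gE i j : ((set_col 0 k g)^T *m set_col 0 k g) i j =
    if (i == k) && (j == k) then sqn g else 0.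
  rewrite !mxE; case: (eqVneq i k) => [->|/negPf ik] /=; last first.
    by rewrite big1 // => l _; rewrite !mxE ik mul0r.
  case: (eqVneq j k) => [->|/negPf jk] /=; last first.
    by rewrite big1 // => l _; rewrite !mxE jk mulr0.
  by apply: eq_bigr => l _; rewrite !mxE eqxx big_ord1 expr2.
have -> : \det G = \det (A'^T *m A') + sqn g * cofactor (A'^T *m A') k k.
  rewrite (expand_det_row G k) (expand_det_row (A'^T *m A') k).
  rewrite (bigD1 k) //= [in RHS](bigD1 k) //=.
  rewrite (@cofactor_eq_col _ _ G (A'^T *m A')); last first.
    by move=> i j /negPf ik _; rewrite /G mxE gE ik addr0.
  rewrite {1}/G mxE gE eqxx mulrDl addrAC; congr (_ + _).
  congr (_ + _); apply: eq_bigr => j /negPf jk.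
  rewrite {1}/G mxE gE eqxx jk addr0 (@cofactor_eq_col _ _ G (A'^T *m A')) //.
  by move=> i l /negPf ik _; rewrite /G mxE gE ik addr0.
(* The cofactor omits row and column [k], the only ones where the two Gram matrices differ. *)
have -> : cofactor (A'^T *m A') k k = cofactor (A^T *m A) k k.
  apply: cofactor_eq_col => i j /negPf ik /negPf jk; rewrite !mxE.
  by apply: eq_bigr => l _; rewrite !mxE ik jk.
have Gu : A^T *m A \in unitmx by rewrite unitmx_mul unitmx_tr Au.
rewrite cofactor_unit // -/(gram A) mulrDr; congr (_ + _).
  by rewrite det_mulmx det_tr det_set_col // /gram det_mulmx det_tr; ring.
rewrite mulrCA; congr (_ * _); rewrite mulrC; congr (_ * _).
(* Diagonal entry [k] of this product is the squared norm of row [k] of [invmx A]. *)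
have -> : invmx (A^T *m A) = invmx A *m (invmx A)^T.
  rewrite -[RHS]mul1mx -(mulVmx Gu) -!mulmxA (mulmxA A) mulmxV // mul1mx.
  by rewrite trmx_inv mulmxV ?unitmx_tr // mulmx1.
by rewrite mxE /sqn big_ord1; apply: eq_bigr => j _; rewrite !mxE expr2.
Qed.

(** * Greedy selection and length of the runs *)

(** A common vector is orthogonal to itself. Together with [ortho_compl_sum] this makes [proj_mx] in
    [residual] a true projection. *)
Lemma ortho_compl_cap (R : realType) (m : nat) (W : 'M[R]_m) :
  (ortho_compl W :&: W)%MS = 0.
Proof.
apply/eqP; apply/rowV0P => x;
  rewrite sub_capmx => /andP[/sub_kermxP xW /submxP[y xE]].
apply/eqP; rewrite -sqn_eq0 sqn_trace {2}xE trmx_mul mulmxA xW mul0mx.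
by rewrite linear0.
Qed.

Lemma ortho_compl_sum (R : realType) (m n : nat) (W : 'M[R]_m) (x : 'M_(n, m)) :
  (x <= ortho_compl W + W)%MS.
Proof.
apply: submx_full; rewrite -col_leq_rank.
rewrite mxrank_disjoint_sum ?ortho_compl_cap // mxrank_ker mxrank_tr subnK //.
exact: rank_leq_row.
Qed.

Lemma col_span_le (R : realType) (m N : nat) (A : 'M[R]_(m, N))
    (J : {set 'I_N}) (i : 'I_N) :
  i \in J -> ((col i A)^T <= col_span A J)%MS.
Proof. by move=> iJ; rewrite (sumsmx_sup i) // genmxE. Qed.

Lemma col_span_colsub (R : realType) (m N n : nat) (A : 'M[R]_(m, N))
    (c : 'I_n -> 'I_N) :
  (col_span A [set c k | k : 'I_n] :=: (colsub c A)^T)%MS.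
Proof.
apply/eqmxP/andP; split.
  apply/sumsmx_subP => _ /imsetP[k _ ->]; rewrite genmxE.
  rewrite (_ : (col (c k) A)^T = row k (colsub c A)^T) ?row_sub //.
  by apply/rowP => j; rewrite !mxE.
apply/row_subP => k.
rewrite (_ : row k _ = (col (c k) A)^T); last by apply/rowP => j; rewrite !mxE.
by apply: col_span_le; rewrite imset_f.
Qed.

Lemma residual_orth (R : realType) (m N : nat) (A : 'M[R]_(m, N))
    (J : {set 'I_N}) (i : 'I_N) :
  residual A J i *m (col_span A J)^T = 0.
Proof. by apply/sub_kermxP; exact: proj_mx_sub. Qed.

Lemma residual_compl (R : realType) (m N : nat) (A : 'M[R]_(m, N))
    (J : {set 'I_N}) (i : 'I_N) :
  ((col i A)^T - residual A J i <= col_span A J)%MS.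
Proof. by rewrite proj_mx_compl_sub // ortho_compl_sum. Qed.

Lemma residual0 (R : realType) (m N : nat) (A : 'M[R]_(m, N)) (J : {set 'I_N})
    (i : 'I_N) :
  i \in J -> residual A J i = 0.
Proof.
by move=> iJ; rewrite /residual proj_mx_0 ?ortho_compl_cap // col_span_le.
Qed.

Lemma norm2_sqr (R : realType) (n : nat) (v : 'rV[R]_n) : norm2 v ^+ 2 = sqn v.
Proof.
rewrite /sqn big_ord1 /norm2 sqr_sqrtr //.
by apply: sumr_ge0 => k _; apply: sqr_ge0.
Qed.

Lemma ler_norm2 (R : realType) (n : nat) (u v : 'rV[R]_n) :
  (norm2 u <= norm2 v) = (sqn u <= sqn v).
Proof. by rewrite -!norm2_sqr ler_pXn2r // nnegrE sqrtr_ge0. Qed.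

(** On the kernel [U], projecting the columns of [E] away from [W] leaves their combination
    unchanged, so its norm is bounded through [n] residuals, each at most the greedy one. *)
Lemma sigma_greedy (R : realType) (m N n k : nat) (A : 'M[R]_(m, N))
    (J : {set 'I_N})
    (i : 'I_N) (e : 'I_n -> 'I_N) :
  (\rank (col_span A J) <= k)%N ->
  (forall l : 'I_N, norm2 (residual A J l) <= norm2 (residual A J i)) ->
  sigma (colsub e A) k ^+ 2 <= n%:R * sqn (residual A J i).
Proof.
move=> rk imax; set W := col_span A J; set E := colsub e A.
pose P := proj_mx (ortho_compl W) W.
pose U := kermx (E^T - E^T *m P).
apply: (@sigma_ler_sub _ _ _ _ _ U); first by rewrite mulr_ge0 // sqn_ge0.
  rewrite mxrank_ker; set r := \rank _.
  (* Columns minus their projections lie in [W], so [U] has codimension at most [k]. *)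
  have : (r <= k)%N.
    by apply: leq_trans rk; apply: mxrankS;
      rewrite proj_mx_compl_sub // ortho_compl_sum.
  lia.
move=> x /sub_kermxP; rewrite mulmxBr => /eqP; rewrite subr_eq0 => /eqP ->.
apply: le_trans (sqn_mulmx_le _ _) _; rewrite mulrC ler_wpM2r ?sqn_ge0 //.
rewrite sqn_row_sum mulr_natl -[X in _ *+ X]card_ord -sumr_const.
apply: ler_sum => l _; rewrite row_mul.
rewrite (_ : row l _ = (col (e l) A)^T); last by apply/rowP => j; rewrite !mxE.
by rewrite -ler_norm2 imax.
Qed.

(** A greedy step with residual [u] multiplies the Gram determinant by [sqn u], while by
    [sigma_greedy] the next squared singular value of any family [e] of [n] columns is at most
    [n%:R * sqn u]. These bounds multiply along the induction. *)
Lemma premaxvol_volume (R : realType) (m N k : nat) (A : 'M[R]_(m, N))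
    (J : {set 'I_N}) :
  premaxvol A k J -> (k <= \rank A)%N ->
  exists c : 'I_k -> 'I_N,
    [/\ injective c, [set c l | l : 'I_k] = J, 0 < gram (colsub c A)
      & forall (n : nat) (e : 'I_n -> 'I_N),
          \prod_(t < k) sigma (colsub e A) t ^+ 2 <= n%:R ^+ k * gram
        (colsub c A)].
Proof.
elim=> {k J} [_|k J i _ IH imax kr].
  have c : 'I_0 -> 'I_N by case.
  exists c; split=> [[]//| | |n e]; last 2 first.
  - by rewrite /gram det_mx00 ltr01.
  - by rewrite big_ord0 expr0 mul1r /gram det_mx00.
  by apply/setP => x; rewrite inE; apply/imsetP => -[[]].
have [c [ci cJ c0 cb]] := IH (ltnW kr).
set u := residual A J i in imax.
have spanE : (col_span A J :=: (colsub c A)^T)%MS by rewrite -cJ;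
  apply: col_span_colsub.
have rk : (\rank (col_span A J) <= k)%N by rewrite spanE rank_leq_row.
(* A zero maximal residual would put every column in the span of [J], giving [A] rank at most
   [k]. *)
have u0 : 0 < sqn u.
  rewrite sqn_gt0; apply: contraTneq kr => u0; rewrite -leqNgt.
  apply: leq_trans rk; rewrite -mxrank_tr; apply: mxrankS.
  apply/row_subP => l; rewrite -tr_col.
  have /eqP rl : residual A J l == 0.
    rewrite -sqn_eq0 eq_le sqn_ge0 andbT.
    by have := imax l; rewrite ler_norm2 u0 => /le_trans; apply;
      rewrite /sqn !big1 // => *; rewrite ?big1 // => *; rewrite mxE expr0n.
  by have := residual_compl A J l; rewrite rl subr0.
have iJ : i \notin J.
  by apply: contraTN u0 => /(residual0 A); rewrite -/u sqn_gt0 negbK => ->.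
pose c2 (l : 'I_k.+1) := if unlift ord0 l is Some l' then c l' else i.
have c2S (l : 'I_k) : c2 (lift ord0 l) = c l by rewrite /c2 liftK.
have c20 : c2 ord0 = i by rewrite /c2 unlift_none.
have [y yE] : exists y : 'cV_k, col i A = u^T + colsub c A *m y.
  have := residual_compl A J i; rewrite spanE => /submxP[D DE].
  exists D^T; apply: trmx_inj; rewrite raddfD /= trmxK trmx_mul trmxK -DE.
  by rewrite addrC subrK.
have gE : gram (colsub c2 A) = sqn u * gram (colsub c A).
  rewrite -(sqn_tr u) -(gram_extend y).
    rewrite -yE; congr (gram _); apply/matrixP => a b; rewrite mxE.
    case: (@split_ordP 1 k b) => b' ->.
      by rewrite (@row_mxEl _ m 1 k) ord1 mxE -c20; congr (A _ (c2 _));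
        apply: val_inj.
    by rewrite (@row_mxEr _ m 1 k) mxE -c2S; congr (A _ (c2 _)); apply: val_inj.
  have /submxP[D ->] : ((colsub c A)^T <= col_span A J)%MS by rewrite spanE.
  by rewrite -mulmxA -[X in _ *m X]trmxK trmx_mul trmxK residual_orth trmx0
    mulmx0.
exists c2; split.
- move=> a b; case: (unliftP ord0 a) => [a'|] ->;
  case: (unliftP ord0 b) => [b'|] ->;
    rewrite ?c2S ?c20 //.
  + by move=> /ci ->.
  + by move=> ca; move: iJ; rewrite -ca -cJ imset_f.
  + by move=> ca; move: iJ; rewrite ca -cJ imset_f.
- apply/setP => x; rewrite in_setU1 -cJ; apply/imsetP/idP.
    case=> a _ ->; case: (unliftP ord0 a) => [a'|] ->;
      rewrite ?c2S ?c20 ?eqxx //.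
    by rewrite imset_f ?orbT.
  case/predU1P => [->|/imsetP[l _ ->]]; first by exists ord0; rewrite ?c20.
  by exists (lift ord0 l); rewrite ?c2S.
- by rewrite gE mulr_gt0.
- move=> n e; rewrite big_ord_recr /= gE.
  rewrite [X in _ <= X](_ : _ = (n%:R ^+ k * gram (colsub c A)) *
    (n%:R * sqn u)); last by rewrite exprS; ring.
  apply: ler_pM => //; rewrite ?sqr_ge0 //.
    by apply: prodr_ge0 => t _; apply: sqr_ge0.
  exact: sigma_greedy.
Qed.

(** * Volume growth and termination of column exchanges *)

Lemma card_replace (N : nat) (J : {set 'I_N}) (i j : 'I_N) :
  i \notin J -> j \in J -> #|replace J i j| = #|J|.
Proof.
move=> iJ jJ; rewrite /replace cardsU1 in_setD1 (negPf iJ) andbF /=.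
by rewrite (cardsD1 j J) jJ.
Qed.

(** Every step gains more than a factor [f]; the volume stays positive along the run, so the
    quotient in [factor] can be cleared. *)
Lemma dominantR_run_volume (R : realType) (m N k : nat) (A : 'M[R]_(m, N))
    (f : R)
    (J0 J : {set 'I_N}) :
  0 < f -> 0 < volume (colset A J0) ^+ 2 -> dominantR_run A f k J0 J ->
  #|J| = #|J0| /\ f ^+ k * volume (colset A J0) ^+ 2 <= volume (colset A J) ^+
    2.
Proof.
move=> f0 + run; elim: run => {k J0 J} [J|k J0 J J' _ IH [i [j [[iJ jJ] fij _
  ->]]]].
  by move=> _; rewrite expr0 mul1r.
move=> V0; have [cJ VJ] := IH V0; split; first by rewrite card_replace.
have VJ0 : 0 < volume (colset A J) ^+ 2.
  by apply: lt_le_trans VJ; rewrite mulr_gt0 // exprn_gt0.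
move: fij; rewrite /factor ltr_pdivlMr // => /ltW; apply: le_trans.
by rewrite exprS -mulrA ler_wpM2l // ltW.
Qed.

Lemma dominantR_run_trans (R : realType) (m N k l : nat) (A : 'M[R]_(m, N))
    (f : R)
    (J0 J1 J2 : {set 'I_N}) :
  dominantR_run A f k J0 J1 -> dominantR_run A f l J1 J2 ->
  dominantR_run A f (k + l) J0 J2.
Proof.
move=> run1 run2; elim: run2 run1 => {l J1 J2} [J|l J1 J J' _ IH st] run1.
  by rewrite addn0.
by rewrite addnS; apply: dominantR_runS (IH run1) st.
Qed.

Lemma dominantR_progress (R : realType) (m N : nat) (A : 'M[R]_(m, N)) (f : R)
    (J : {set 'I_N}) :
  dominantR_stop A f J \/ exists J', dominantR_step A f J J'.
Proof.
pose P (ij : 'I_N * 'I_N) := (ij.1 \notin J) && (ij.2 \in J).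
case: (pickP (fun ij => P ij && (f < factor A J ij.1 ij.2))) => [ij0|none];
  last first.
  left=> i j iJ jJ; rewrite leNgt; apply/negP => fij.
  by have := none (i, j); rewrite /P /= iJ jJ fij.
case/andP => Pij0 fij0; right.
case: (@arg_maxP _ _ _ ij0 P (fun ij => factor A J ij.1 ij.2) Pij0) => -[i j]
  /andP[iJ jJ] max.
exists (replace J i j), i, j; split=> // [|i' j' iJ' jJ'].
  by apply: lt_le_trans fij0 _; apply: max.
by apply: (max (i', j')); rewrite /P /= iJ' jJ'.
Qed.

(** By [dominantR_progress] a run that has not stopped can be prolonged, and [b] forbids doing so
    forever. *)
Lemma dominantR_terminates (R : realType) (m N b : nat) (A : 'M[R]_(m, N))
    (f : R)
    (J : {set 'I_N}) :
  (forall k J', dominantR_run A f k J J' -> (k <= b)%N) ->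
  exists (k : nat) (J' : {set 'I_N}), dominantR_run A f k J J' /\
    dominantR_stop A f J'.
Proof.
move=> bd.
(* [n] is fuel: a further step raises [k] and lowers [n], and [n = 0] would mean a run longer than
   [b]. *)
suff H n : forall k J', (b < k + n)%N -> dominantR_run A f k J J' ->
    exists l J'', dominantR_run A f l J J'' /\ dominantR_stop A f J''.
  by apply: (H b.+1 0%N J); [rewrite ltnS | constructor].
elim: n => [|n IH] k J' lt_b run.
  by move: lt_b; rewrite addn0 ltnNge (bd _ _ run).
have [st|[J'' st]] := dominantR_progress A f J'; first by exists k, J'.
by apply: (IH k.+1 J''); [rewrite addSnnS | apply: dominantR_runS st].
Qed.

Lemma premaxvol_exists (R : realType) (m N r : nat) (A : 'M[R]_(m, N)) :
  (r <= \rank A)%N -> exists J : {set 'I_N}, premaxvol A r J.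
Proof.
move=> rA; elim: r rA => [|r IH] rA; first by exists set0; constructor.
have [J pJ] := IH (ltnW rA).
have N0 : (0 < N)%N by apply: leq_ltn_trans (leq0n _) (leq_trans rA
  (rank_leq_col _)).
case: (@arg_maxP _ _ _ (Ordinal N0) xpredT (fun l => norm2
  (residual A J l)) isT) => i _ imax.
by exists (i |: J); apply: premaxvolS => // l; apply: imax.
Qed.

Lemma premaxvol_card (R : realType) (m N r : nat) (A : 'M[R]_(m, N))
    (J : {set 'I_N}) :
  premaxvol A r J -> (r <= \rank A)%N -> #|J| = r.
Proof.
move=> pJ rA; have [c [ci <- _ _]] := premaxvol_volume pJ rA.
by rewrite card_imset ?card_ord.
Qed.

Lemma premaxvol_volume_gt0 (R : realType) (m N r : nat) (A : 'M[R]_(m, N))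
    (J : {set 'I_N}) :
  premaxvol A r J -> (r <= \rank A)%N -> 0 < volume (colset A J) ^+ 2.
Proof.
move=> pJ rA; have [c [ci cJ c0 _]] := premaxvol_volume pJ rA.
by rewrite (gram_colset A ci cJ) // (leq_trans rA) ?rank_leq_row.
Qed.

(** The greedy bound with [e] the enumeration of [J], so that all [r] singular values enter the
    product. *)
Lemma volume_le_premaxvol (R : realType) (m N r : nat) (A : 'M[R]_(m, N))
    (J0 J : {set 'I_N}) :
  premaxvol A r J0 -> (r <= \rank A)%N -> #|J| = r ->
  volume (colset A J) ^+ 2 <= r%:R ^+ r * volume (colset A J0) ^+ 2.
Proof.
move=> pJ rA Jr; subst r; have [c [ci cJ c0 cb]] := premaxvol_volume pJ rA.
have rm : (#|J| <= m)%N by rewrite (leq_trans rA) ?rank_leq_row.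
rewrite (gram_colset A ci cJ) // volume_sqr // det_gram.
exact: (cb _ (fun k : 'I_#|J| => enum_val k)).
Qed.

(** Volume growth and the greedy bound give [f ^+ k <= r%:R ^+ r]; then logarithms are taken. *)
Lemma dominantR_run_length (R : realType) (m N r k : nat) (A : 'M[R]_(m, N))
    (f : R)
    (J0 J : {set 'I_N}) :
  (1 <= r)%N -> (r <= \rank A)%N -> 1 < f -> premaxvol A r J0 ->
  dominantR_run A f k J0 J -> k%:R <= r%:R * logb f r%:R.
Proof.
move=> r1 rA f1 pJ run.
have f0 : 0 < f := lt_trans ltr01 f1.
have V0 := premaxvol_volume_gt0 pJ rA.
have [cJ VJ] := dominantR_run_volume f0 V0 run.
have := le_trans VJ (volume_le_premaxvol pJ rA (etrans cJ
  (premaxvol_card pJ rA))).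
rewrite (ler_pM2r V0) => fr.
rewrite /logb mulrA ler_pdivlMr ?ln_gt0 // !mulr_natl -!lnXn ?ltr0n //.
by rewrite ler_ln // posrE exprn_gt0 // ltr0n.
Qed.

(** * Singular values of block triangular matrices *)

(** In the coordinates [(z - X y, y)] the block triangular matrix decouples, as
    [A (z - X y) + B y = A z]. *)
Lemma mulmx_block_tr (R : comPzRingType) (r p q : nat) (A : 'M[R]_r)
    (B : 'M_(r, q))
    (C : 'M_(p, q)) (X : 'M_(r, q)) (z : 'rV_r) (y : 'rV_q) :
  A *m X = B ->
  row_mx (z - y *m X^T) y *m (block_mx A B 0 C)^T = row_mx (z *m A^T) (y *m
    C^T).
Proof.
move=> <-; rewrite tr_block_mx mul_row_block trmx_mul trmx0 mulmx0 add0r.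
by rewrite mulmxBl mulmxA subrK.
Qed.

(** Describes the test spaces of both singular value bounds: all [(z - X y, y)] with [z] in [U] and
    [y] in [V]. *)
Lemma block_lower_rows (R : pzRingType) (r q k l : nat) (U : 'M[R]_(k, r))
    (V : 'M_(l, q))
    (X : 'M_(r, q)) (x : 'rV_(k + l)) :
  x *m (block_mx U 0 0 V *m block_mx 1%:M 0 (- X^T) 1%:M) =
  row_mx (lsubmx x *m U - rsubmx x *m V *m X^T) (rsubmx x *m V).
Proof.
rewrite -{1}[x]hsubmxK mulmxA mul_row_block !mulmx0 addr0 add0r mul_row_block.
by rewrite !mulmx1 mulmx0 add0r mulmxN.
Qed.

Lemma rank_block_lower (R : fieldType) (r q k l : nat) (U : 'M[R]_(k, r))
    (V : 'M_(l, q))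
    (X : 'M_(r, q)) :
  \rank (block_mx U 0 0 V *m block_mx 1%:M 0 (- X^T) 1%:M) =
    (\rank U + \rank V)%N.
Proof.
rewrite mxrankMfree ?rank_diag_block_mx // row_free_unit unitmxE.
by rewrite det_lblock !det1 mulr1 unitr1.
Qed.

Lemma sigma_sqr_le_sqn (R : realType) (m n i : nat) (B : 'M[R]_(m, n)) :
  sigma B i ^+ 2 <= sqn B.
Proof.
apply: (@sigma_ler_sub _ _ _ _ _ 1%:M); rewrite ?sqn_ge0 ?mxrank1 ?leq_addr //.
by move=> x _; rewrite mulrC -(sqn_tr B) sqn_mulmx_le.
Qed.


Lemma sqn_le_mulmx_inv (R : realFieldType) (r : nat) (A : 'M[R]_r)
    (z : 'rV[R]_r) :
  A \in unitmx -> sqn z <= sqn (invmx A) * sqn (z *m A^T).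
Proof.
move=> Au; rewrite mulrC -(sqn_tr (invmx A)) trmx_inv.
by rewrite -{1}(mulmxK (_ : A^T \in unitmx) z) ?unitmx_tr // sqn_mulmx_le.
Qed.

(** Since [|z| <= |A^-1| |A z|] for all [z], every singular value of [A] is at least the reciprocal
    of the Frobenius norm of [invmx A]. *)
Lemma sigma_invmx_ge1 (R : realType) (r i : nat) (A : 'M[R]_r) :
  A \in unitmx -> (i < r)%N -> 1 <= sigma A i ^+ 2 * sqn (invmx A).
Proof.
move=> Au ir; have r0 : (0 < r)%N by apply: leq_ltn_trans ir.
have s0 : 0 < sqn (invmx A).
  rewrite sqn_gt0; apply: contraTneq Au => A0.
  rewrite -unitmx_inv A0 -row_free_unit -row_leq_rank mxrank0.
  by rewrite -ltnNge.
rewrite -ler_pdivrMr // div1r.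
apply: (@sub_ler_sigma _ _ _ _ _ 1%:M); rewrite ?mxrank1 // => z _.
by rewrite ler_pdivrMl // sqn_le_mulmx_inv.
Qed.

(** Courant-Fischer on the [(z - X y, y)] with [z] in the extremal space of [A], a space of
    codimension [i]. The image has squared norm [|A z|^2 + |C y|^2], and [z = x + X y] bounds
    [z]. *)
Lemma sigma_block_le (R : realType) (r p q i : nat) (A : 'M[R]_r)
    (B : 'M_(r, q))
    (C : 'M_(p, q)) (K : R) :
  A \in unitmx -> (i < r)%N ->
  1 + sqn (invmx A *m B) + sqn (invmx A) * sqn C <= K ->
  sigma (block_mx A B 0 C) i ^+ 2 <= K * sigma A i ^+ 2.
Proof.
move=> Au ir HK; set X := invmx A *m B in HK.
have AX : A *m X = B by rewrite mulKVmx.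
have s1 := sigma_invmx_ge1 Au ir; set s := sigma A i ^+ 2 in s1 *.
have s0 : 0 <= s by apply: sqr_ge0.
have K0 : 0 <= K.
  by apply: le_trans HK; rewrite !addr_ge0 ?mulr_ge0 ?sqn_ge0 ?ler01.
have [U rU UA] := sigma_upper_space A (ltnW ir).
apply: (@sigma_ler_sub _ _ _ _ _ (block_mx U 0 0
  (1%:M : 'M_q) *m block_mx 1%:M 0 (- X^T) 1%:M)).
- exact: mulr_ge0.
- by rewrite rank_block_lower mxrank1 rU; lia.
move=> _ /submxP[w ->]; rewrite block_lower_rows mulmx1.
set z := lsubmx w *m U; set y := rsubmx w.
rewrite (mulmx_block_tr _ _ _ AX) !sqn_row_mx; set x := z - _.
have zA : sqn (z *m A^T) <= s * sqn z by apply: UA; exact: submxMl.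
have zx : sqn z <= (1 + sqn X) * (sqn x + sqn y).
  rewrite (_ : z = x + y *m X^T); last by rewrite subrK.
  apply: sqnD_le; rewrite ?sqn_ge0 ?ler01 ?mul1r //.
  by rewrite mulrC -(sqn_tr X) sqn_mulmx_le.
have yC : sqn (y *m C^T) <= sqn y * sqn C by rewrite -(sqn_tr C) sqn_mulmx_le.
have x0 := sqn_ge0 x; have y0 := sqn_ge0 y; have C0 := sqn_ge0 C.
(* The inequality [1 <= s * sqn (invmx A)] puts the factor [s] in front of the [C] term. *)
have yC' : sqn y * sqn C <= s * (sqn (invmx A) * sqn C) * (sqn x + sqn y).
  have -> : sqn y * sqn C = 1 * (sqn C * sqn y) by ring.
  rewrite [X in _ <= X](_ : _ = s * sqn (invmx A) * (sqn C * (sqn x + sqn y)));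
    last by ring.
  by apply: ler_pM; rewrite ?mulr_ge0 // ler_wpM2l // lerDr.
have zx' := ler_wpM2l s0 zx.
have := ler_wpM2r (addr_ge0 x0 y0) (ler_wpM2l s0 HK).
rewrite -[in X in _ -> X](mulrC s) => /(le_trans _); apply.
apply: le_trans (lerD zA yC) _; apply: le_trans (lerD zx' yC') _.
by rewrite le_eqVlt; apply/orP; left; apply/eqP; ring.
Qed.

(** Here [y] runs over the span of the [j + 1] leading right singular vectors of [C] and [z] is
    free: a space of dimension [r + j + 1]. *)
Lemma sigma_block_ge (R : realType) (r p q j : nat) (A : 'M[R]_r)
    (B : 'M_(r, q))
    (C : 'M_(p, q)) (K : R) :
  A \in unitmx -> (j < q)%N ->
  1 + sqn (invmx A *m B) + sqn (invmx A) * sqn C <= K ->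
  sigma C j ^+ 2 <= K * sigma (block_mx A B 0 C) (r + j) ^+ 2.
Proof.
move=> Au jq HK; set X := invmx A *m B in HK.
have AX : A *m X = B by rewrite mulKVmx.
have tC := sigma_sqr_le_sqn j C; set t := sigma C j ^+ 2 in tC *.
have t0 : 0 <= t by apply: sqr_ge0.
have K0 : 0 < K.
  apply: lt_le_trans HK; rewrite -addrA ltr_pwDl ?ltr01 //.
  by rewrite addr_ge0 ?mulr_ge0 ?sqn_ge0.
have [V rV VC] := sigma_lower_space C jq.
rewrite -ler_pdivrMl //.
apply: (@sub_ler_sigma _ _ _ _ _ (block_mx
  (1%:M : 'M_r) 0 0 V *m block_mx 1%:M 0 (- X^T) 1%:M)).
  by rewrite rank_block_lower mxrank1 rV addnS.
move=> _ /submxP[w ->]; rewrite block_lower_rows mulmx1.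
set z := lsubmx w; set y := rsubmx w *m V.
rewrite (mulmx_block_tr _ _ _ AX) !sqn_row_mx -mulrA ler_pdivrMl //.
set a := sqn (z *m _); set c := sqn (y *m _).
have yc : t * sqn y <= c by apply: VC; exact: submxMl.
have za : sqn z <= sqn (invmx A) * a by apply: sqn_le_mulmx_inv.
have a0 : 0 <= a by apply: sqn_ge0.
have c0 : 0 <= c by apply: sqn_ge0.
(* The part in [z] uses [t <= sqn C], the part in [y] uses [t * sqn y <= c]; [sqnD_le] joins
   them. *)
have xt : t * sqn (z - y *m X^T) <= (sqn (invmx A) * sqn C + sqn X) * (a + c).
  have -> : t = sigma C j ^+ 2 by [].
  rewrite -sqn_scale scalerBr.
  apply: sqnD_le; rewrite ?mulr_ge0 ?sqn_ge0 //.
    rewrite sqn_scale -/t (mulrC t) [X in _ <= X]mulrAC.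
    by apply: ler_pM; rewrite ?sqn_ge0.
  rewrite sqn_opp sqn_scale -/t.
  apply: le_trans (ler_wpM2l t0 (sqn_mulmx_le _ _)) _.
  by rewrite sqn_tr mulrA mulrC ler_wpM2l ?sqn_ge0.
have := ler_wpM2r (addr_ge0 a0 c0) HK; apply: le_trans.
rewrite mulrDr; apply: le_trans (lerD xt yc) _.
have -> : (1 + sqn X + sqn (invmx A) * sqn C) * (a + c) =
  (sqn (invmx A) * sqn C + sqn X) * (a + c) + (a + c) by ring.
by rewrite lerD2l lerDr.
Qed.

(** * Dominant columns yield a strong rank-revealing decomposition *)

(** [L] lists the values of [c], then the remaining indices; [s] sends an index to its position in
    [L]. *)
Lemma perm_to_front (N r : nat) (c : 'I_r -> 'I_N) :
  injective c -> exists s : 'S_N, forall k : 'I_r, s (c k) = k :> nat.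
Proof.
move=> ci; pose L := codom c ++ [seq i <- enum 'I_N | i \notin codom c].
have memL i : i \in L.
  by rewrite mem_cat mem_filter mem_enum inE andbT orbN.
have uL : uniq L.
  rewrite cat_uniq (map_inj_uniq ci) enum_uniq filter_uniq ?enum_uniq // andbT.
  by apply/hasPn => i; rewrite mem_filter => /andP[].
have sL : size L = N.
  rewrite -[RHS](size_enum_ord N); apply: perm_size.
  by apply: uniq_perm; rewrite ?enum_uniq // => i; rewrite memL mem_enum.
have iL i : (index i L < N)%N by rewrite -[X in (_ < X)%N]sL index_mem.
pose g i := Ordinal (iL i).
have gi : injective g.
  by move=> i j [eq_ij]; rewrite -(nth_index i (memL i)) eq_ij nth_index.
exists (perm gi) => k; rewrite permE /= index_cat codom_f /codom.
by rewrite /image_mem index_map // index_enum_ord.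
Qed.

(* p and q stand for m - r and N - r, so that em and eN can be substituted. *)
Lemma rrqr_of_dominant (R : realType) (m N r p q : nat) (em : (r + p)%N = m)
    (eN : (r + q)%N = N) (f : R) (A : 'M[R]_(m, N)) (c : 'I_r -> 'I_N)
    (Q : 'M[R]_m) (T : 'M[R]_(m, r)) (s : 'S_N) :
  1 < f -> 0 < gram (colsub c A) ->
  (forall (i : 'I_N) (k : 'I_r), i \notin codom c ->
     gram (colsub (fun l => if l == k then i else c l) A) <= f * gram (colsub c
       A)) ->
  full_qr (colsub c A) Q T -> (forall k, s (c k) = k :> nat) ->
  exists (Ar : 'M[R]_r) (Br : 'M[R]_(r, q)) (Cr : 'M[R]_(p, q)),
    let rho := Num.sqrt (1 + f ^+ 2 * r%:R * q%:R) in
    [/\ Q^T *m A *m perm_mx s = castmx (em, eN) (block_mx Ar Br 0 Cr),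
        upper_triangular Ar /\ Ar \in unitmx,
        (forall i : nat, (i < r)%N -> sigma Ar i >= sigma A i / rho),
        (forall j : nat, (j < minn p q)%N ->
           sigma Cr j <= sigma A (r + j) * rho)
      & forall (i : 'I_r) (j : 'I_q), `|(invmx Ar *m Br) i j| <= f].
Proof.
move=> f1 + + [QQ TU cE] sc; subst m N => g0 stop.
pose T1 : 'M_(r + p, r + q) := Q^T *m A *m perm_mx s.
have T1def : T1 = Q^T *m A *m perm_mx s by [].
have T1E i j : T1 i j = (Q^T *m A) i (s^-1%g j).
  by rewrite /T1 -[s]invgK -col_permE mxE invgK.
have sV k : s^-1%g (lshift q k) = c k.
  by apply: (@perm_inj _ s); rewrite permKV; apply: val_inj; rewrite /= sc.
have QTE n (e : 'I_n -> 'I_(r + q)) i l : (Q^T *m A) i (e l) =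
  (Q^T *m colsub e A) i l.
  by rewrite !mxE; apply: eq_bigr => k _; rewrite !mxE.
have QcE : Q^T *m colsub c A = T by rewrite cE mulmxA QQ mul1mx.
have T1l i k : T1 i (lshift q k) = T i k by rewrite T1E sV QTE QcE.
clearbody T1.
pose Ar := ulsubmx T1; pose Br := ursubmx T1; pose Cr := drsubmx T1.
(* The first [r] columns of [T1] are [T], which is upper triangular, so the lower left block is
   zero. *)
have T1B : T1 = block_mx Ar Br 0 Cr.
  rewrite -[LHS]submxK; congr block_mx; apply/matrixP => i j;
    rewrite !mxE T1l TU //=.
  by rewrite (leq_trans (ltn_ord j)) ?leq_addr.
have QQt : Q^T^T *m Q^T = 1%:M by rewrite trmxK; apply: orth_mxC.
have gE : gram (colsub c A) = gram Ar.
  rewrite -(gram_orth (colsub c A) QQt) QcE (_ : T = col_mx Ar 0).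
    by rewrite /gram tr_col_mx mul_row_col mulmx0 addr0.
  apply/matrixP => i k; rewrite -T1l T1B.
  case: (split_ordP i) => i' ->; first by rewrite block_mxEul col_mxEu.
  by rewrite block_mxEdl col_mxEd.
have Au : Ar \in unitmx.
  rewrite unitmxE unitfE; apply: contraTneq g0 => d0.
  by rewrite gE /gram det_mulmx d0 mulr0 ltxx.
pose X := invmx Ar *m Br.
(* The dominance inequality for replacing column [k] by the one moved to position [r + j], evaluated
   by [gram_set_col]. *)
have bound k j : X k j ^+ 2 + sqn (row k (invmx Ar)) * sqn (col j Cr) <= f.
  set i := s^-1%g (rshift r j).
  have iJ : i \notin codom c.
    apply/negP => /codomP[l il]; have := sc l; rewrite -il permKV /=.
    by have := ltn_ord l; lia.
  have := stop i k iJ; rewrite -(gram_orth (colsub (fun l => _) A) QQt).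
  rewrite (_ : _ *m _ = col_mx (set_col Ar k (col j Br)) (set_col 0 k
    (col j Cr))); last first.
    apply/matrixP => a l; rewrite -QTE.
    have -> : (Q^T *m A) a (if l == k then i else c l) =
        if l == k then T1 a (rshift r j) else T1 a (lshift q l).
      by case: ifP => _; rewrite T1E // sV.
    rewrite T1B; case: (split_ordP a) => a' ->.
      by rewrite block_mxEul block_mxEur col_mxEu [in RHS]mxE [in RHS]mxE.
    by rewrite block_mxEdl block_mxEdr col_mxEd [in RHS]mxE [in RHS]mxE mxE.
  rewrite gram_set_col // gE mulrC ler_pM2r -?gE //.
  rewrite (_ : (invmx Ar *m col j Br) k 0 = X k j) //.
  by rewrite !mxE; apply: eq_bigr => l _; rewrite !mxE.
have f0 : 0 < f := lt_trans ltr01 f1.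
have f_le : f <= f ^+ 2 by rewrite expr2 ler_pMl // ltW.
pose K : R := 1 + f ^+ 2 * r%:R * q%:R.
(* Sum of [bound] over all [r * q] pairs, combined with [f <= f ^+ 2]. *)
have HK : 1 + sqn X + sqn (invmx Ar) * sqn Cr <= K.
  rewrite -addrA lerD2l (sqn_row_sum (invmx Ar)) (sqn_col_sum Cr) big_distrlr
    /=.
  rewrite /sqn -big_split /=.
  apply: le_trans (_ : \sum_(i < r) \sum_(j < q) f <= _).
    by apply: ler_sum => i _; rewrite -big_split /=; apply: ler_sum => j _;
      apply: bound.
  rewrite !sumr_const !card_ord -mulrnA mulnC -[f *+ _]mulr_natr natrM mulrA.
  by rewrite !ler_wpM2r ?ler0n.
have K0 : 0 < K by apply: lt_le_trans HK;
  rewrite -addrA ltr_pwDl ?ltr01 ?addr_ge0 ?mulr_ge0 ?sqn_ge0.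
have rho2 : Num.sqrt K ^+ 2 = K by rewrite sqr_sqrtr // ltW.
have rho0 : 0 < Num.sqrt K by rewrite sqrtr_gt0.
have PP : perm_mx s *m (perm_mx s)^T = 1%:M :> 'M[R]_(r + q).
  by rewrite tr_perm_mx -perm_mxM mulgV perm_mx1.
have sigE i : sigma A i = sigma (block_mx Ar Br 0 Cr) i.
  by rewrite -(sigma_orthogonal A i QQt PP) -T1B T1def.
exists Ar, Br, Cr; rewrite -/K; split.
- by rewrite castmx_id -T1B T1def.
- by split=> // i j ji; rewrite /Ar !mxE T1l TU.
- move=> i ir; rewrite ler_pdivrMr // sigE -(ler_pXn2r
  (n := 2)) ?nnegrE ?mulr_ge0 ?sigma_ge0 ?(ltW rho0) //.
  by rewrite exprMn rho2 mulrC; apply: sigma_block_le.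
- move=> j; rewrite leq_min => /andP[_ jq].
  rewrite sigE -(ler_pXn2r (n := 2)) ?nnegrE ?mulr_ge0 ?sigma_ge0 ?(ltW rho0)
    //.
  by rewrite exprMn rho2 mulrC; apply: sigma_block_ge.
(* The first summand of [bound] gives [X i j ^+ 2 <= f <= f ^+ 2]. *)
- move=> i j; rewrite -(ler_pXn2r (n := 2)) ?nnegrE ?normr_ge0 ?(ltW f0) //
  real_normK ?num_real //.
  apply: le_trans f_le; apply: le_trans (bound i j).
  by rewrite lerDl mulr_ge0 ?sqn_ge0.
Qed.

(** Dominance speaks of index sets, the determinant identities of enumerations: redirecting [c] at
    [k] to [i] enumerates [replace J i (c k)]. *)
Lemma dominant_gram (R : realType) (m N r : nat) (A : 'M[R]_(m, N)) (f : R)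
    (J : {set 'I_N}) (c : 'I_r -> 'I_N) (i : 'I_N) (k : 'I_r) :
  (r <= m)%N -> injective c -> [set c l | l : 'I_r] = J ->
  0 < gram (colsub c A) -> dominantR_stop A f J -> i \notin codom c ->
  gram (colsub (fun l => if l == k then i else c l) A) <= f * gram (colsub c A).
Proof.
move=> rm ci cJ g0 stop ic; pose c' l := if l == k then i else c l;
  rewrite -/c'.
have Jc x : (x \in J) = (x \in codom c).
  by rewrite -cJ; apply/imsetP/codomP => -[l]; [move=> _|] => ->; exists l.
have ck l : (c l == i) = false.
  by apply: contraNF ic => /eqP <-; apply: codom_f.
have c'i : injective c'.
  move=> a b; rewrite /c'; have [->|_] := eqVneq a k;
    have [->|_] := eqVneq b k => //.
  - by move/esym/eqP; rewrite ck.
  - by move/eqP; rewrite ck.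
  - exact: ci.
have c'J : [set c' l | l : 'I_r] = replace J i (c k).
  apply/setP => x; rewrite !inE Jc; apply/imsetP/idP.
    case=> l _ ->; rewrite /c'; have [_|lk] := eqVneq l k;
      first by rewrite eqxx.
    by rewrite (inj_eq ci) lk codom_f orbT.
  case/predU1P => [->|/andP[+ /codomP[l xl]]]; first by exists k;
    rewrite /c' ?eqxx.
  by rewrite xl (inj_eq ci) => /negPf lk; exists l; rewrite /c' ?lk.
have iJ : i \notin J by rewrite Jc.
have kJ : c k \in J by rewrite Jc codom_f.
have := stop i (c k) iJ kJ.
by rewrite /factor (gram_colset A ci cJ rm) (gram_colset A c'i c'J rm)
  ler_pdivrMr.
Qed.

(** The absolute constant is 1. Every run, however ties are broken, obeys the step bound and can be
    prolonged to a stopping set; the decomposition is obtained for every ordering [c] of the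
    selected columns. *)
Theorem theorem2 (R : realType) :
  exists C : R,
  forall (m N r : nat) (A : 'M[R]_(m, N)) (f : R),
    (1 <= r)%N -> (r <= \rank A)%N -> 1 < f ->
    (exists J0 : {set 'I_N}, premaxvol A r J0) /\
    forall J0 : {set 'I_N}, premaxvol A r J0 ->
    forall (k : nat) (J : {set 'I_N}), dominantR_run A f k J0 J ->
      [/\ k%:R <= C * (r%:R * logb f r%:R),
          (exists (k' : nat) (J' : {set 'I_N}),
             dominantR_run A f k' J J' /\ dominantR_stop A f J'),
          #|J| = r
        & dominantR_stop A f J ->
          forall c : 'I_r -> 'I_N, injective c -> [set c k | k : 'I_r] = J ->
          let Ahat := colsub c A in
          (exists (Q : 'M[R]_m) (T : 'M[R]_(m, r)), full_qr Ahat Q T) /\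
          forall (Q : 'M[R]_m) (T : 'M[R]_(m, r)), full_qr Ahat Q T ->
          exists s : 'S_N,
            (forall k : 'I_r, s (c k) = k :> nat) /\
            strong_rrqr r f A (perm_mx s) Q (Q^T *m A *m perm_mx s)].
Proof.
exists 1 => m N r A f r1 rA f1; split; first exact: premaxvol_exists.
move=> J0 pJ k J run.
have f0 : 0 < f := lt_trans ltr01 f1.
have rm : (r <= m)%N := leq_trans rA (rank_leq_row A).
have rN : (r <= N)%N := leq_trans rA (rank_leq_col A).
have V0 := premaxvol_volume_gt0 pJ rA.
have [cardJ VJ] := dominantR_run_volume f0 V0 run.
have len l J' : dominantR_run A f l J0 J' -> l%:R <= r%:R * logb f r%:R.
  exact: dominantR_run_length.
split; first by rewrite mul1r; apply: len run.
(* A continuation of length [l] gives a run of length [k + l] from [J0], so the same bound caps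
   [l]. *)
- apply: (@dominantR_terminates _ _ _ (Num.bound
  (r%:R * logb f r%:R))) => l J' run'.
  have le := len _ _ (dominantR_run_trans run run').
  have /archi_boundP lt := le_trans (ler0n R (k + l)) le.
  by have := le_lt_trans le lt; rewrite ltr_nat => /ltnW;
    apply: leq_trans (leq_addl _ _).
- by rewrite cardJ (premaxvol_card pJ rA).
move=> stop c ci cJ Ahat; split; first exact: qr_exists.
move=> Q T qr; have [s sc] := perm_to_front ci; exists s; split=> //.
have QQ : orthogonal_mx Q by case: qr.
split; [exact: perm_mx_is_perm|by []| |].
  by rewrite !mulmxA (orth_mxC QQ) mul1mx.
have g0 : 0 < gram (colsub c A).
  by rewrite -(gram_colset A ci cJ rm); apply: lt_le_trans VJ;
    rewrite mulr_gt0 // exprn_gt0.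
exists (subnKC rm), (subnKC rN).
apply: (rrqr_of_dominant _ _ f1 g0 _ qr sc) => i l.
exact: (dominant_gram l rm ci cJ g0 stop).
Qed.
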